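(* Let $R$ be a prime ring with extended centroid $C$, let $K,L$ be noncentral Lie ideals of $R$, and let $m,n$ be positive integers. Then $K^mL^n$ contains a nonzero ideal of $R$ except when $KC=LC=Ca+C$ for any noncentral element $a\in K$. (That is: if it is not the case that $KC=LC=Ca+C$ for every $a\in K\setminus Z(R)$, then $K^mL^n$ contains a nonzero ideal of $R$.)
   Context: Rings are associative, not necessarily with unity; ''ideal'' means two-sided ideal. $Z(R)$ is the center of $R$, and $[x,y]:=xy-yx$. For subsets $A,B$ of a ring, $[A,B]$ (resp. $AB$) denotes the additive subgroup generated by all $[x,y]$ (resp. $xy$) with $x\in A$, $y\in B$; $K^m$ is the product of $m$ copies of $K$. A Lie ideal of $R$ is an additive subgroup $L$ with $[L,R]\subseteq L$; it is central if $L\subseteq Z(R)$, noncentral otherwise. $R$ is prime if $xRy=0$ implies $x=0$ or $y=0$. For $R$ prime, $Q_s(R)$ is the Martindale symmetric ring of quotients of $R$ (a prime ring containing $R$), and the extended centroid $C$ is the center of $Q_s(R)$, which is a field. $KC$, $LC$ denote the $C$-spans of $K,L$ in $Q_s(R)$; $Ca+C=\{\beta a+\gamma:\beta,\gamma\in C\}$. *)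

(* Defs.v *)
From HB Require Import structures.
From mathcomp Require Import all_boot monoid all_algebra.
From mathcomp Require Import boolp classical_sets.

Set Implicit Arguments.
Unset Strict Implicit.
Unset Printing Implicit Defensive.

Import GRing.Theory.
Local Open Scope classical_set_scope.
Local Open Scope ring_scope.
Local Open Scope quotient_scope.

(* MathComp rings are unital. A rng is a zmodType with an associative,
   biadditive product; the product is the semigroup law of monoid.v, written **
   so as not to clash with the product of unital rings. *)
Reserved Notation "x ** y" (at level 40, left associativity).
Notation "x ** y" := (monoid.mul x%R y%R) : ring_scope.

HB.mixin Record Zmodule_Semigroup_isRng R of GRing.Zmodule R & Semigroup R := {
  rng_mulDl : forall x y z : R, (x + y) ** z = x ** z + y ** z;
  rng_mulDr : forall x y z : R, x ** (y + z) = x ** y + x ** z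
}.

#[short(type="rngType")]
HB.structure Definition Rng :=
  {R of Zmodule_Semigroup_isRng R & GRing.Zmodule R & Semigroup R}.

(* As usual, the zero ring is not counted as a prime ring. *)
HB.mixin Record Rng_isPrime R of Rng R := {
  rng_nontrivial : exists x : R, x <> 0;
  rng_primeP : forall x y : R, (forall r, x ** r ** y = 0) -> x = 0 \/ y = 0
}.

#[short(type="primeRngType")]
HB.structure Definition PrimeRng := {R of Rng_isPrime R & Rng R}.

Section Zmod.
Variable V : zmodType.

Definition subgroup (A : set V) : Prop :=
  A 0 /\ forall x y, A x -> A y -> A (x - y).

Definition addspan (S : set V) : set V := smallest subgroup S.

Lemma subgroup_addspan S : subgroup (addspan S).
Proof.
split=> [A [[A0 _] _]//|x y Sx Sy A [Ag SA]].
by apply: Ag.2; [apply: Sx|apply: Sy].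
Qed.

Lemma subgroupD A x y : subgroup A -> A x -> A y -> A (x + y).
Proof.
move=> [A0 AB] Ax Ay; have ANy : A (- y) by rewrite -sub0r; apply: AB.
by rewrite -(opprK y); apply: AB.
Qed.

Lemma subgroupI A B : subgroup A -> subgroup B -> subgroup (A `&` B).
Proof.
move=> [A0 AB] [B0 BB]; split=> // x y [Ax Bx] [Ay By].
by split; [apply: AB|apply: BB].
Qed.

End Zmod.

Section RngSets.
Variable R : rngType.
Implicit Types (A B I J K L : set R) (x y : R).

Definition lie x y : R := x ** y - y ** x.

Definition center : set R := [set x | forall y, lie x y = 0].

Definition lieset A B : set R :=
  addspan [set z | exists x y, [/\ A x, B y & z = lie x y]].

Definition prodset A B : set R :=
  addspan [set z | exists x y, [/\ A x, B y & z = x ** y]].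

(* A rng has no unit, so only positive exponents are meaningful; the value at
   exponent 0 is junk. *)
Definition powset A (m : nat) : set R := iter m.-1 (prodset A) A.

Definition lie_ideal L : Prop := subgroup L /\ lieset L setT `<=` L.

Definition noncentral L : Prop := ~ (L `<=` center).

Definition ideal I : Prop :=
  subgroup I /\ forall x r, I x -> I (x ** r) /\ I (r ** x).

Definition nonzero_ideal I : Prop := ideal I /\ exists2 x, I x & x <> 0.

Lemma rng_mul0 x : 0 ** x = 0.
Proof. by apply: (@addrI _ (0 ** x)); rewrite -rng_mulDl !addr0. Qed.

Lemma rng_mulr0 x : x ** 0 = 0.
Proof. by apply: (@addrI _ (x ** 0)); rewrite -rng_mulDr !addr0. Qed.

Lemma rng_mulNr x y : x ** - y = - (x ** y).
Proof. by apply: (@addrI _ (x ** y)); rewrite -rng_mulDr !subrr rng_mulr0. Qed.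

Lemma rng_mulNl x y : - x ** y = - (x ** y).
Proof. by apply: (@addrI _ (x ** y)); rewrite -rng_mulDl !subrr rng_mul0. Qed.

Lemma ideal_setT : ideal setT.
Proof. by []. Qed.

Lemma idealI I J : ideal I -> ideal J -> ideal (I `&` J).
Proof.
move=> [Ig Im] [Jg Jm]; split; first exact: subgroupI.
by move=> x r [/Im-/(_ r)[? ?] /Jm-/(_ r)[? ?]].
Qed.

Lemma ideal_prodset I J : ideal I -> ideal J -> ideal (prodset I J).
Proof.
move=> [Ig Im] [Jg Jm]; have [P0 PB] := subgroup_addspan
  [set z | exists x y, [/\ I x, J y & z = x ** y]].
split=> // z r; pose A := [set z | prodset I J (z ** r) /\ prodset I J (r ** z)].
apply: (@smallest_sub _ (@subgroup R) _ A) => [|_ [x [y [Ix Jy ->]]]].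
  split=> [|x y [xr rx] [yr ry]]; first by split; rewrite ?rng_mul0 ?rng_mulr0.
  by split; rewrite ?rng_mulDl ?rng_mulDr ?rng_mulNl ?rng_mulNr; apply: PB.
split; apply: sub_gen_smallest.
  by exists x, (y ** r); split=> //; [case: (Jm y r Jy)|rewrite mulgA].
by exists (r ** x), y; split=> //; [case: (Im x r Ix)|rewrite mulgA].
Qed.

End RngSets.

Arguments center R : clear implicits.

Section NonzeroIdeals.
Variable R : primeRngType.
Implicit Types I J : set R.

Lemma nonzero_ideal_setT : nonzero_ideal [set: R].
Proof. by split=> //; have [x x0] := @rng_nontrivial R; exists x. Qed.

Lemma nonzero_idealM I J :
  nonzero_ideal I -> nonzero_ideal J -> nonzero_ideal (prodset I J).
Proof.
move=> [Ii [x Ix x0]] [Ji [y Jy y0]]; split; first exact: ideal_prodset.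
have [r xry] : exists r, x ** r ** y <> 0.
  apply: contrapT => /forallNP xRy.
  by have [] := @rng_primeP R x y (fun r => contrapT (xRy r)).
exists (x ** r ** y) => //; apply: sub_gen_smallest; exists (x ** r), y; split=> //.
by case: (Ii.2 x r Ix).
Qed.

Lemma nonzero_idealI I J :
  nonzero_ideal I -> nonzero_ideal J -> nonzero_ideal (I `&` J).
Proof.
move=> nI nJ; have [Ii Ji] := (nI.1, nJ.1); split; first exact: idealI.
have [_ [z IJz z0]] := nonzero_idealM nI nJ; exists z => //.
have [Kg _] := idealI Ii Ji; apply: (smallest_sub Kg _ IJz) => _ [x [y [Ix Jy ->]]].
by split; [case: (Ii.2 x y Ix)|case: (Ji.2 y x Jy)].
Qed.

End NonzeroIdeals.

(* The Martindale symmetric ring of quotients. An element q is given by a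
   nonzero ideal D with q D and D q contained in R, through the maps
   x |-> q x (a right R-module map D -> R) and x |-> x q (a left R-module map
   D -> R), which are balanced: x (q y) = (x q) y. Two such data are identified
   when they agree on some nonzero ideal. The maps are total functions on R of
   which only the values on D matter. *)
Section Bimultiplier.
Variable R : primeRngType.

Record bimult := Bimult {
  bdom : set R;
  lact : R -> R; (* x |-> q x *)
  ract : R -> R; (* x |-> x q *)
  bdom_ideal : nonzero_ideal bdom;
  lactD : forall x y, bdom x -> bdom y -> lact (x + y) = lact x + lact y;
  ractD : forall x y, bdom x -> bdom y -> ract (x + y) = ract x + ract y;
  lactM : forall x r, bdom x -> lact (x ** r) = lact x ** r;
  ractM : forall x r, bdom x -> ract (r ** x) = r ** ract x;
  lract : forall x y, bdom x -> bdom y -> x ** lact y = ract x ** y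
}.

HB.instance Definition _ := gen_eqMixin bimult.
HB.instance Definition _ := gen_choiceMixin bimult.

Implicit Types p q : bimult.

Definition bagree p q : Prop := exists D : set R,
  [/\ nonzero_ideal D, D `<=` bdom p `&` bdom q
    & forall x, D x -> lact p x = lact q x /\ ract p x = ract q x].

Definition bequiv p q : bool := `[< bagree p q >].

Lemma bequiv_refl : reflexive bequiv.
Proof. by move=> p; apply/asboolP; exists (bdom p); split=> //; apply: bdom_ideal. Qed.

Lemma bequiv_sym : symmetric bequiv.
Proof.
suff H p q : bagree p q -> bagree q p by move=> p q; apply/asboolP/asboolP; apply: H.
move=> [D [nD sD eD]]; exists D; split=> // x Dx; first by have [] := sD x Dx.
by have [-> ->] := eD x Dx.
Qed.

Lemma bequiv_trans : transitive bequiv.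
Proof.
move=> q p r /asboolP[D [nD sD eD]] /asboolP[E [nE sE eE]]; apply/asboolP.
exists (D `&` E); split=> [|x [Dx Ex]|x [Dx Ex]]; first exact: nonzero_idealI.
  by have [? _] := sD x Dx; have [_ ?] := sE x Ex.
by have [-> ->] := eD x Dx; apply: eE.
Qed.

Canonical bequiv_equiv := EquivRel bequiv bequiv_refl bequiv_sym bequiv_trans.

Lemma bdomI_agree p q :
  (forall x, bdom p x -> bdom q x -> lact p x = lact q x) ->
  (forall x, bdom p x -> bdom q x -> ract p x = ract q x) -> bagree p q.
Proof.
move=> el er; exists (bdom p `&` bdom q); split=> //.
  by apply: nonzero_idealI; apply: bdom_ideal.
by move=> x [px qx]; split; [apply: el|apply: er].
Qed.

Lemma bdomB p x y : bdom p x -> bdom p y -> bdom p (x - y).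
Proof. exact: (bdom_ideal p).1.1.2. Qed.

Lemma bdom0 p : bdom p 0.
Proof. exact: (bdom_ideal p).1.1.1. Qed.

Lemma lact0 p : lact p 0 = 0.
Proof. by apply: (@addrI _ (lact p 0)); rewrite -lactD ?addr0//; apply: bdom0. Qed.

Lemma ract0 p : ract p 0 = 0.
Proof. by apply: (@addrI _ (ract p 0)); rewrite -ractD ?addr0//; apply: bdom0. Qed.

Lemma bdomN p x : bdom p x -> bdom p (- x).
Proof. by move=> px; rewrite -sub0r; apply: bdomB => //; apply: bdom0. Qed.

Lemma lactN p x : bdom p x -> lact p (- x) = - lact p x.
Proof.
move=> px; apply: (@addrI _ (lact p x)); rewrite -lactD ?subrr ?lact0//.
exact: bdomN.
Qed.

Lemma ractN p x : bdom p x -> ract p (- x) = - ract p x.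
Proof.
move=> px; apply: (@addrI _ (ract p x)); rewrite -ractD ?subrr ?ract0//.
exact: bdomN.
Qed.

Lemma act_prodset p q (A B : set R) : ideal A -> ideal B ->
    A `<=` bdom q -> B `<=` bdom p ->
  prodset A B `<=` [set z | [/\ A z, B z, B (lact q z) & A (ract p z)]].
Proof.
move=> [Ag Am] [Bg Bm] Aq Bp; apply: smallest_sub => [|_ [x [y [Ax By ->]]]].
  split=> [|x y [Ax Bx Bqx Apx] [Ay By Bqy Apy]].
    by rewrite /= lact0 ract0; split; (apply: Ag.1 || apply: Bg.1).
  split; [exact: Ag.2|exact: Bg.2|..].
    rewrite lactD ?lactN; [exact: Bg.2|exact: Aq|exact: Aq|apply: bdomN; exact: Aq].
  rewrite ractD ?ractN; [exact: Ag.2|exact: Bp|exact: Bp|apply: bdomN; exact: Bp].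
split; [by case: (Am x y Ax)|by case: (Bm y x By)|..].
  by rewrite lactM; [case: (Bm y (lact q x) By)|apply: Aq].
by rewrite ractM; [case: (Am x (ract p y) Ax)|apply: Bp].
Qed.

Lemma bdom_prodset p q z : prodset (bdom q) (bdom p) z ->
  [/\ bdom q z, bdom p z, bdom p (lact q z) & bdom q (ract p z)].
Proof. by apply: act_prodset => //; apply: (bdom_ideal _).1. Qed.

Definition bscal (r : R) : bimult.
Proof.
apply: (@Bimult setT (fun x => r ** x) (fun x => x ** r)) => *;
  by [exact: nonzero_ideal_setT|rewrite ?rng_mulDl ?rng_mulDr ?mulgA].
Defined.

Definition bzero : bimult.
Proof.
apply: (@Bimult setT (fun=> 0) (fun=> 0)) => *;
  by [exact: nonzero_ideal_setT|rewrite ?addr0 ?rng_mul0 ?rng_mulr0].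
Defined.

Definition bopp p : bimult.
Proof.
apply: (@Bimult (bdom p) (fun x => - lact p x) (fun x => - ract p x)).
- exact: bdom_ideal.
- by move=> x y px py; rewrite lactD// opprD.
- by move=> x y px py; rewrite ractD// opprD.
- by move=> x r px; rewrite lactM// rng_mulNl.
- by move=> x r px; rewrite ractM// rng_mulNr.
- by move=> x y px py; rewrite rng_mulNl rng_mulNr lract.
Defined.

Definition badd p q : bimult.
Proof.
apply: (@Bimult (bdom p `&` bdom q) (fun x => lact p x + lact q x)
  (fun x => ract p x + ract q x)).
- by apply: nonzero_idealI; apply: bdom_ideal.
- by move=> x y [px qx] [py qy]; rewrite !lactD// addrACA.
- by move=> x y [px qx] [py qy]; rewrite !ractD// addrACA.
- by move=> x r [px qx]; rewrite !lactM// rng_mulDl.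
- by move=> x r [px qx]; rewrite !ractM// rng_mulDr.
- by move=> x y [px qx] [py qy]; rewrite rng_mulDl rng_mulDr !lract.
Defined.

Definition bmul p q : bimult.
Proof.
apply: (@Bimult (prodset (bdom q) (bdom p)) (fun x => lact p (lact q x))
  (fun x => ract q (ract p x))).
- by apply: nonzero_idealM; apply: bdom_ideal.
- by move=> x y /bdom_prodset[? ? ? ?] /bdom_prodset[? ? ? ?]; rewrite !lactD.
- by move=> x y /bdom_prodset[? ? ? ?] /bdom_prodset[? ? ? ?]; rewrite !ractD.
- by move=> x r /bdom_prodset[? ? ? ?]; rewrite !lactM.
- by move=> x r /bdom_prodset[? ? ? ?]; rewrite !ractM.
- by move=> x y /bdom_prodset[? ? ? ?] /bdom_prodset[? ? ? ?]; rewrite !lract.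
Defined.

End Bimultiplier.

Definition Qs (R : primeRngType) : Type := {eq_quot @bequiv_equiv R}.

Section Qs.
Variable R : primeRngType.

HB.instance Definition _ := Choice.on (Qs R).
HB.instance Definition _ := EqQuotient.on (Qs R).

Implicit Types (p q r : bimult R) (u v w : Qs R).

Lemma Qs_eqP p q : \pi_(Qs R) p = \pi_(Qs R) q <-> bagree p q.
Proof.
by split=> [/eqmodP/asboolP|pq]; last by apply/eqmodP/asboolP.
Qed.

Lemma Qs_ind (P : Qs R -> Prop) : (forall p, P (\pi_(Qs R) p)) -> forall u, P u.
Proof. by move=> Pp u; rewrite -[u]reprK; apply: Pp. Qed.

Definition Qs_zero : Qs R := \pi_(Qs R) (bzero R).
Definition Qs_opp u : Qs R := \pi_(Qs R) (bopp (repr u)).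
Definition Qs_add u v : Qs R := \pi_(Qs R) (badd (repr u) (repr v)).
Definition Qs_mul u v : Qs R := \pi_(Qs R) (bmul (repr u) (repr v)).

Lemma repr_agree p : bagree (repr (\pi_(Qs R) p)) p.
Proof. by apply/Qs_eqP; rewrite reprK. Qed.

Lemma pi_opp p : Qs_opp (\pi_(Qs R) p) = \pi_(Qs R) (bopp p).
Proof.
apply/Qs_eqP; have [D [nD sD eD]] := repr_agree p; exists D; split=> // x Dx /=.
by have [-> ->] := eD x Dx.
Qed.

Lemma pi_add p q : Qs_add (\pi_(Qs R) p) (\pi_(Qs R) q) = \pi_(Qs R) (badd p q).
Proof.
apply/Qs_eqP; have [D [nD sD eD]] := repr_agree p.
have [E [nE sE eE]] := repr_agree q.
exists (D `&` E); split=> [|x [Dx Ex]|x [Dx Ex]] /=; first exact: nonzero_idealI.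
  by have [? ?] := sD x Dx; have [? ?] := sE x Ex.
by have [-> ->] := eD x Dx; have [-> ->] := eE x Ex.
Qed.

Lemma pi_mul p q : Qs_mul (\pi_(Qs R) p) (\pi_(Qs R) q) = \pi_(Qs R) (bmul p q).
Proof.
apply/Qs_eqP; have [D [nD sD eD]] := repr_agree p.
have [E [nE sE eE]] := repr_agree q.
have sub (A B A' B' : set R) : A `<=` A' -> B `<=` B' ->
    prodset A B `<=` prodset A' B'.
  move=> AA' BB'; apply: sub_smallest2r; first exact: subgroup_addspan.
  by move=> _ [x [y [/AA' ? /BB' ? ->]]]; exists x, y.
exists (prodset E D); split; first exact: nonzero_idealM.
  by move=> x EDx; split; apply: sub EDx => y; [case/sE|case/sD|case/sE|case/sD].
move=> x EDx /=.
have [Ex Dx Dqx Epx] := act_prodset nE.1 nD.1 (fun y Ey => (sE y Ey).2)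
  (fun y Dy => (sD y Dy).2) EDx.
have [_ ->] := eD x Dx; have [-> _] := eE x Ex.
by have [-> _] := eD _ Dqx; have [_ ->] := eE _ Epx.
Qed.

Lemma Qs_addA : associative Qs_add.
Proof.
elim/Qs_ind=> p; elim/Qs_ind=> q; elim/Qs_ind=> r; rewrite !pi_add.
by apply/Qs_eqP/bdomI_agree => x _ _ /=; rewrite addrA.
Qed.

Lemma Qs_addC : commutative Qs_add.
Proof.
elim/Qs_ind=> p; elim/Qs_ind=> q; rewrite !pi_add.
by apply/Qs_eqP/bdomI_agree => x _ _ /=; rewrite addrC.
Qed.

Lemma Qs_add0 : left_id Qs_zero Qs_add.
Proof.
elim/Qs_ind=> p; rewrite pi_add.
by apply/Qs_eqP/bdomI_agree => x _ _ /=; rewrite add0r.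
Qed.

Lemma Qs_addN : left_inverse Qs_zero Qs_opp Qs_add.
Proof.
elim/Qs_ind=> p; rewrite pi_opp pi_add.
by apply/Qs_eqP/bdomI_agree => x _ _ /=; rewrite addNr.
Qed.

HB.instance Definition _ :=
  GRing.isZmodule.Build (Qs R) Qs_addA Qs_addC Qs_add0 Qs_addN.

Lemma Qs_mulA : associative Qs_mul.
Proof.
elim/Qs_ind=> p; elim/Qs_ind=> q; elim/Qs_ind=> r; rewrite !pi_mul.
by apply/Qs_eqP/bdomI_agree.
Qed.

HB.instance Definition _ := isSemigroup.Build (Qs R) Qs_mulA.

Lemma Qs_mulDl u v w : (u + v) ** w = u ** w + v ** w.
Proof.
elim/Qs_ind: u => p; elim/Qs_ind: v => q; elim/Qs_ind: w => r.
have := (pi_add, pi_mul); rewrite /GRing.add /monoid.mul /= => E; rewrite !E.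
apply/Qs_eqP/bdomI_agree => //= x _ [/bdom_prodset[? ? ? ?] /bdom_prodset[? ? ? ?]].
by rewrite ractD.
Qed.

Lemma Qs_mulDr u v w : u ** (v + w) = u ** v + u ** w.
Proof.
elim/Qs_ind: u => p; elim/Qs_ind: v => q; elim/Qs_ind: w => r.
have := (pi_add, pi_mul); rewrite /GRing.add /monoid.mul /= => E; rewrite !E.
apply/Qs_eqP/bdomI_agree => //= x _ [/bdom_prodset[? ? ? ?] /bdom_prodset[? ? ? ?]].
by rewrite lactD.
Qed.

HB.instance Definition _ :=
  Zmodule_Semigroup_isRng.Build (Qs R) Qs_mulDl Qs_mulDr.

Definition Qs_inj (r : R) : Qs R := \pi_(Qs R) (bscal r).

Lemma Qs_injD x y : Qs_inj (x + y) = Qs_inj x + Qs_inj y.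
Proof.
have := pi_add; rewrite /GRing.add /= => ->.
by apply/Qs_eqP/bdomI_agree => z _ _ /=; rewrite ?rng_mulDl ?rng_mulDr.
Qed.

Lemma Qs_injM x y : Qs_inj (x ** y) = Qs_inj x ** Qs_inj y.
Proof.
have := pi_mul; rewrite /monoid.mul /= => ->.
by apply/Qs_eqP/bdomI_agree => z _ _ /=; rewrite mulgA.
Qed.

Lemma annihl_eq0 (I : set R) z :
  nonzero_ideal I -> (forall x, I x -> z ** x = 0) -> z = 0.
Proof.
move=> [[_ Im] [x Ix x0]] zI; have [r|//|//] := @rng_primeP R z x.
by rewrite -mulgA zI//; case: (Im x r Ix).
Qed.

Lemma annihr_eq0 (I : set R) z :
  nonzero_ideal I -> (forall x, I x -> x ** z = 0) -> z = 0.
Proof.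
move=> [[_ Im] [x Ix x0]] zI; have [r|//|//] := @rng_primeP R x z.
by rewrite zI//; case: (Im x r Ix).
Qed.

Lemma Qs_inj_injective : injective Qs_inj.
Proof.
move=> x y /Qs_eqP[D [nD _ eD]]; apply/eqP; rewrite -subr_eq0; apply/eqP.
apply: (annihl_eq0 nD) => z /eD[/= xy _].
by rewrite rng_mulDl rng_mulNl xy subrr.
Qed.

Lemma Qs_lact p x : bdom p x -> \pi_(Qs R) p ** Qs_inj x = Qs_inj (lact p x).
Proof.
move=> px; have := pi_mul; rewrite /monoid.mul /= => ->.
apply/Qs_eqP/bdomI_agree => z /= /(@bdom_prodset R p (bscal x))[_ pz _ _] _.
  by rewrite lactM.
by rewrite lract.
Qed.

Lemma Qs_ract p x : bdom p x -> Qs_inj x ** \pi_(Qs R) p = Qs_inj (ract p x).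
Proof.
move=> px; have := pi_mul; rewrite /monoid.mul /= => ->.
apply/Qs_eqP/bdomI_agree => z /= /(@bdom_prodset R (bscal x) p)[pz _ _ _] _.
  by rewrite lract.
by rewrite ractM.
Qed.

(* Together with the two lemmas above and the constructor [Bimult], this gives
   the properties characterising the symmetric ring of quotients. *)
Lemma Qs_faithful (I : set R) u : nonzero_ideal I ->
  (forall x, I x -> u ** Qs_inj x = 0) \/ (forall x, I x -> Qs_inj x ** u = 0) ->
  u = 0.
Proof.
move=> nI; elim/Qs_ind: u => p uI.
have nJ := nonzero_idealI nI (bdom_ideal p).
have inj0 : Qs_inj 0 = 0.
  by apply: (@addrI _ (Qs_inj 0)); rewrite -Qs_injD !addr0.
have zero : forall z, bdom p z -> lact p z = 0 /\ ract p z = 0.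
  case: uI => uI z pz.
    have l0 x : (I `&` bdom p) x -> lact p x = 0.
      by move=> [Ix px]; apply: Qs_inj_injective; rewrite -Qs_lact// inj0 uI.
    have r0 (w : R) : bdom p w -> ract p w = 0.
      move=> pw; apply: (annihl_eq0 nJ) => x Jx.
      by rewrite -lract ?l0 ?rng_mulr0//; case: Jx.
    split; last exact: r0.
    apply: (annihr_eq0 (bdom_ideal p)) => w pw.
    by rewrite lract// r0// rng_mul0.
  have r0 x : (I `&` bdom p) x -> ract p x = 0.
    by move=> [Ix px]; apply: Qs_inj_injective; rewrite -Qs_ract// inj0 uI.
  have l0 (w : R) : bdom p w -> lact p w = 0.
    move=> pw; apply: (annihr_eq0 nJ) => x Jx.
    by rewrite lract ?r0 ?rng_mul0//; case: Jx.
  split; first exact: l0.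
  apply: (annihl_eq0 (bdom_ideal p)) => w pw.
  by rewrite -lract// l0// rng_mulr0.
by apply/Qs_eqP/bdomI_agree => z /= /zero[].
Qed.

Definition extended_centroid : set (Qs R) := center (Qs R).

Definition Cspan (A : set R) : set (Qs R) :=
  prodset (Qs_inj @` A) extended_centroid.

Definition CaC (a : R) : set (Qs R) :=
  [set beta ** Qs_inj a + gamma
    | beta in extended_centroid & gamma in extended_centroid].

End Qs.

(* Main.v *)
(* Every ideal I and noncentral a satisfy u[a, x]w in the product of [a, R] and
   [I, R], for u in [a, R] and x in I, so that a Lie ideal containing [I, R]
   multiplied by any noncentral Lie ideal contains a nonzero ideal; this also
   gives the step from KL to K^m L^n. By Herstein, L contains such an [I, R] as
   soon as [L, L] is nonzero. If [K, K] = [L, L] = 0 but t = [a, b] is nonzero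
   for some a in K and b in L, then t is a central element of both K and L, which
   reduces KL to [a, R](K + L). If K + L is commutative, Martindale's lemma puts
   K and L inside Ca + C for every noncentral a, and KC = LC = Ca + C. *)
Require Import Defs.
From mathcomp Require Import all_boot all_algebra.
From mathcomp Require Import boolp classical_sets.

Local Open Scope classical_set_scope.

(** * Commutator identities, products of sets and Lie ideals in a rng *)

Section RngLemmas.
Set Implicit Arguments.
Unset Strict Implicit.
Import GRing.Theory.
Local Open Scope ring_scope.
Variable R : rngType.
Implicit Types (A B K L N : set R) (a b r s t u v w x y z : R).

Lemma rng_mulBl x y z : (x - y) ** z = x ** z - y ** z.
Proof. by rewrite rng_mulDl rng_mulNl. Qed.

Lemma rng_mulBr x y z : x ** (y - z) = x ** y - x ** z.
Proof. by rewrite rng_mulDr rng_mulNr. Qed.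

Lemma lieC x y : lie x y = - lie y x.
Proof. by rewrite /lie opprB. Qed.

Lemma liexx x : lie x x = 0.
Proof. exact: subrr. Qed.

Lemma lieDl x y z : lie (x + y) z = lie x z + lie y z.
Proof. by rewrite /lie rng_mulDl rng_mulDr opprD addrACA. Qed.

Lemma lieDr x y z : lie x (y + z) = lie x y + lie x z.
Proof. by rewrite /lie rng_mulDl rng_mulDr opprD addrACA. Qed.

Lemma lieBl x y z : lie (x - y) z = lie x z - lie y z.
Proof. by rewrite lieDl /lie rng_mulNl rng_mulNr -opprD. Qed.

Lemma lieMr x y z : lie x (y ** z) = lie x y ** z + y ** lie x z.
Proof. by rewrite /lie rng_mulBl rng_mulBr !mulgA addrA subrK. Qed.

Lemma lieMl x y z : lie (x ** y) z = x ** lie y z + lie x z ** y.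
Proof. by rewrite /lie rng_mulBl rng_mulBr !mulgA addrA subrK. Qed.

(** With x in an ideal I, this and its mirror image [lie_mulCr] turn a one-sided multiple of [a, x]
    into commutators from [I, R] and factors a. *)
Lemma lie_mulCl a x y : lie a x ** y = a ** lie x y - lie x (a ** y).
Proof. by rewrite lieMr opprD addrCA subrr addr0 -rng_mulNl -lieC. Qed.

Lemma lie_mulCr a x y : y ** lie a x = lie (y ** a) x - lie y x ** a.
Proof. by rewrite lieMl addrK. Qed.

Lemma subgroupN A x : subgroup A -> A x -> A (- x).
Proof. by move=> [A0 AB] Ax; rewrite -sub0r; apply: AB. Qed.

Lemma subgroupB A x y : subgroup A -> A x -> A y -> A (x - y).
Proof. by move=> [_ AB]; apply: AB. Qed.

Lemma subgroup_prodset A B : subgroup (prodset A B).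
Proof. exact: subgroup_addspan. Qed.

Lemma prodset_mul A B x y : A x -> B y -> prodset A B (x ** y).
Proof. by move=> Ax By; apply: sub_gen_smallest; exists x, y. Qed.

Lemma prodset_ind A B N : subgroup N ->
  (forall x y, A x -> B y -> N (x ** y)) -> prodset A B `<=` N.
Proof.
by move=> sN AB; apply: smallest_sub => // _ [x [y [Ax By ->]]]; apply: AB.
Qed.

Lemma subgroup_mull u N : subgroup N -> subgroup [set z | N (u ** z)].
Proof.
move=> [N0 NB]; split=> [|x y Nx Ny] /=; first by rewrite rng_mulr0.
by rewrite rng_mulBr; apply: NB.
Qed.

Lemma subgroup_mulr u N : subgroup N -> subgroup [set z | N (z ** u)].
Proof.
move=> [N0 NB]; split=> [|x y Nx Ny] /=; first by rewrite rng_mul0.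
by rewrite rng_mulBl; apply: NB.
Qed.

Lemma prodset_sub_assocl A B N :
  prodset A (prodset B N) `<=` prodset (prodset A B) N.
Proof.
apply: prodset_ind => [|x y Ax]; first exact: subgroup_prodset.
move: y; apply: prodset_ind => [|y z By Nz].
  exact/subgroup_mull/subgroup_prodset.
by rewrite /= mulgA; apply: prodset_mul => //; apply: prodset_mul.
Qed.

Lemma prodset_sub_assocr A B N :
  prodset (prodset A B) N `<=` prodset A (prodset B N).
Proof.
apply: prodset_ind => [|x y ABx Ny]; first exact: subgroup_prodset.
move: x ABx; apply: prodset_ind => [|x z Ax Bz].
  exact/subgroup_mulr/subgroup_prodset.
by rewrite /= -mulgA; apply: prodset_mul => //; apply: prodset_mul.
Qed.

Lemma lie_ideal_lie L x r : lie_ideal L -> L x -> L (lie x r).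
Proof.
by move=> [_ LL] Lx; apply: LL; apply: sub_gen_smallest; exists x, r.
Qed.

Lemma lie_ideal_liel L x r : lie_ideal L -> L x -> L (lie r x).
Proof.
move=> lL Lx; rewrite lieC; apply: subgroupN; first exact: lL.1.
exact: lie_ideal_lie.
Qed.

Lemma lie_idealI L : subgroup L -> (forall x r, L x -> L (lie x r)) -> lie_ideal L.
Proof.
move=> sL LL; split=> //.
by apply: smallest_sub => // _ [x [r [Lx _ ->]]]; apply: LL.
Qed.

Lemma noncentralP L : noncentral L -> exists2 a, L a & ~ center R a.
Proof.
move=> nL; apply: contrapT => H; apply: nL => x Lx; apply: contrapT => cx.
by apply: H; exists x.
Qed.

Lemma noncentral_lie a : ~ center R a -> exists y, lie a y <> 0.
Proof.
by move=> na; apply: contrapT => /forallNP H; apply: na => y; apply: contrapT.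
Qed.

(* Since [xy, r] = [x, yr] + [y, rx], also [LL, R] lies in L. *)
Lemma lie_ideal_lieM L x y r : lie_ideal L -> L x -> L y -> L (lie (x ** y) r).
Proof.
move=> lL Lx Ly.
have -> : lie (x ** y) r = lie x (y ** r) + lie y (r ** x).
  by rewrite /lie !mulgA addrA subrK.
by apply: subgroupD; [exact: lL.1|exact: lie_ideal_lie..].
Qed.

(** With t = [l, l'], the identity zt = [l, zl'] - [l, z]l' writes zt as an element of L minus a
    product of two, so [zt, R] lies in L. The right factor y is handled by xty = [xt, y] + (yx)t. *)
Lemma lie_ideal_lieMlieM L x y l l' r : lie_ideal L -> L l -> L l' ->
  L (lie (x ** lie l l' ** y) r).
Proof.
move=> lL Ll Ll'.
have key z s : L (lie (z ** lie l l') s).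
  have -> : z ** lie l l' = lie l (z ** l') - lie l z ** l'.
    by rewrite lieMr addrC addKr.
  rewrite lieBl; apply: lL.1.2.
    by apply: lie_ideal_lie => //; apply: lie_ideal_lie.
  by apply: lie_ideal_lieM => //; apply: lie_ideal_lie.
have -> : x ** lie l l' ** y = lie (x ** lie l l') y + y ** x ** lie l l'.
  by rewrite {2}/lie mulgA subrK.
rewrite lieDl; apply: subgroupD => //; first exact: lL.1.
by apply: lie_ideal_lie.
Qed.

(* Expand [b, [a, xy]] = 0 by the Leibniz rule, and then replace y by yz. *)
Lemma lie_mul_lie a b x y z : (forall r, lie b (lie a r) = 0) ->
  lie a x ** y ** lie b z = - (lie b x ** y ** lie a z).
Proof.
move=> ba.
have E s r : lie a s ** lie b r = - (lie b s ** lie a r).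
  apply/eqP; rewrite -addr_eq0 -(ba (s ** r)) lieMr lieDr !lieMr !ba.
  by rewrite rng_mul0 rng_mulr0 add0r addr0.
have := E x (y ** z); rewrite !lieMr !rng_mulDr !mulgA E opprD rng_mulNl.
by move/addrI.
Qed.

End RngLemmas.

(** * Nonzero ideals inside products of Lie ideals of a prime ring *)

Section PrimeLemmas.
Set Implicit Arguments.
Unset Strict Implicit.
Import GRing.Theory.
Local Open Scope ring_scope.
Variable R : primeRngType.
Implicit Types (A B I J K L N : set R) (a b p q r s t u v w x y z : R).

Definition contains_ideal N := exists2 I, nonzero_ideal I & I `<=` N.

Definition contains_lie_ideal N :=
  exists2 I, nonzero_ideal I & forall x y, I x -> N (lie x y).

Lemma contains_idealW N N' : N `<=` N' -> contains_ideal N -> contains_ideal N'.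
Proof. by move=> NN' [I nI IN]; exists I => // x /IN /NN'. Qed.

Lemma contains_ideal_lie N : contains_ideal N -> contains_lie_ideal N.
Proof.
move=> [I nI IN]; exists I => // x y Ix; apply: IN.
have [Ixy Iyx] := nI.1.2 x y Ix.
exact: nI.1.1.2.
Qed.

Lemma prime_neq0 x y : x <> 0 -> y <> 0 -> exists r, x ** r ** y <> 0.
Proof.
move=> x0 y0; apply: contrapT => /forallNP xRy.
by have [] := @rng_primeP R x y (fun r => contrapT (xRy r)).
Qed.

(** Without a unit, the ideal generated by w is the sum of Zw, wR, Rw and RwR, hence the four
    membership hypotheses. The elements with these four properties form the largest ideal inside
    N. *)
Lemma contains_ideal_core N w : subgroup N -> w <> 0 -> N w ->
  (forall r, N (w ** r)) -> (forall s, N (s ** w)) ->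
  (forall s r, N (s ** w ** r)) -> contains_ideal N.
Proof.
move=> sN w0 Nw Nwr Nsw Nswr.
exists [set z | [/\ N z, forall r, N (z ** r), forall s, N (s ** z)
  & forall s r, N (s ** z ** r)]]; last by move=> z [].
split; last by exists w.
split; first split.
- by split=> [|r|s|s r]; rewrite ?rng_mulr0 ?rng_mul0; apply: sN.1.
- move=> x y [x1 x2 x3 x4] [y1 y2 y3 y4].
  by split=> [|r|s|s r]; rewrite ?rng_mulBr ?rng_mulBl; apply: sN.2.
move=> x y [x1 x2 x3 x4]; split.
  split=> // [r|s|s r]; first by rewrite -mulgA.
    by rewrite mulgA.
  by have := x4 s (y ** r); rewrite !mulgA.
by split=> // [s|s r]; rewrite mulgA.
Qed.

(** If a commuted with I, then x[a, r] = [a, xr] - [a, x]r = 0 for x in I, and [a, r] = 0 by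
    primeness. *)
Lemma lie_ideal_elt_neq0 a I : ~ center R a -> nonzero_ideal I ->
  exists2 x, I x & lie a x <> 0.
Proof.
move=> na nI; apply: contrapT => H; apply: na => r.
apply: (annihr_eq0 nI) => x Ix; have := lieMr a x r.
have aI y : I y -> lie a y = 0.
  by move=> Iy; apply: contrapT => ay; apply: H; exists y.
have [Ixr _] := nI.1.2 x r Ix.
by rewrite (aI x) // (aI (x ** r)) // rng_mul0 add0r.
Qed.

Lemma contains_ideal_lie_mul_lie a I N : ~ center R a -> nonzero_ideal I ->
  subgroup N ->
  (forall x y z y' w, I y -> I y' -> N (x ** lie a y ** z ** lie a y' ** w)) ->
  contains_ideal N.
Proof.
move=> na nI sN NP.
have [y Iy ay] := lie_ideal_elt_neq0 na nI.
(* Primeness, used three times, makes [a, y]x[a, y]z[a, y]w[a, y] nonzero. The inner two commutators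
   fit [NP]; the outer two keep a factor on each side even when nothing more is multiplied on. *)
have [z w0] := prime_neq0 ay ay.
have [x w1] := prime_neq0 ay w0; have [w w2] := prime_neq0 w1 ay.
apply: (contains_ideal_core sN w2) => [|r|s|s r].
- by have := NP (lie a y ** x) y z y (w ** lie a y) Iy Iy; rewrite !mulgA.
- by have := NP (lie a y ** x) y z y (w ** lie a y ** r) Iy Iy; rewrite !mulgA.
- by have := NP (s ** lie a y ** x) y z y (w ** lie a y) Iy Iy; rewrite !mulgA.
- by have := NP (s ** lie a y ** x) y z y (w ** lie a y ** r) Iy Iy; rewrite !mulgA.
Qed.

(* For u = [a, y] also ua = [a, ya] lies in A, so that
   u[a, x]w = (ua)[x, w] - u[x, aw] lies in AB for x in I. *)
Lemma contains_ideal_prodsetl a A B : ~ center R a -> (forall y, A (lie a y)) ->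
  contains_lie_ideal B -> contains_ideal (prodset A B).
Proof.
move=> na Aa [I nI IB]; have sN := subgroup_prodset A B.
apply: (contains_ideal_lie_mul_lie na nI sN) => x y z x' w _ Ix'.
have E1 y1 w1 : prodset A B (lie a y1 ** (lie a x' ** w1)).
  rewrite [lie a x' ** w1]lie_mulCl rng_mulBr mulgA.
  apply: (subgroupB sN); apply: prodset_mul.
  - by have := Aa (y1 ** a); rewrite lieMr liexx rng_mulr0 addr0.
  - exact: IB.
  - exact: Aa.
  - exact: IB.
(* An inner factor z1 moves past v = [a, x']w1 at the cost of [v, z1], which lies in B because v
   lies in I. *)
have E2 y1 z1 w1 : prodset A B (lie a y1 ** z1 ** (lie a x' ** w1)).
  have -> : lie a y1 ** z1 ** (lie a x' ** w1) =
      lie a y1 ** (lie a x' ** (w1 ** z1)) - lie a y1 ** lie (lie a x' ** w1) z1.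
    by rewrite {3}/lie rng_mulBr !mulgA opprB addrC subrK.
  apply: (subgroupB sN); first exact: E1.
  apply: prodset_mul; first exact: Aa.
  apply: IB; have Iax : I (lie a x').
    by apply: nI.1.1.2; case: (nI.1.2 x' a Ix').
  by case: (nI.1.2 _ w1 Iax).
have -> : x ** lie a y = lie a (x ** y) - lie a x ** y by rewrite lieMr addrC addKr.
rewrite -[_ ** lie a x' ** w]mulgA (rng_mulBl _ _ z).
rewrite (rng_mulBl _ _ (lie a x' ** w)); apply: (subgroupB sN); first exact: E2.
by rewrite -[lie a x ** y ** z]mulgA; apply: E2.
Qed.

(** Mirror argument: for v = [b, y] also bv = [b, by] lies in B, so that w[b, x]v = [wb, x]v -
    [w, x](bv) lies in AB for x in I. *)
Lemma contains_ideal_prodsetr b A B : ~ center R b -> (forall y, B (lie b y)) ->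
  contains_lie_ideal A -> contains_ideal (prodset A B).
Proof.
move=> nb Bb [I nI IA]; have sN := subgroup_prodset A B.
have E1 y1 x' w1 : I x' -> prodset A B ((w1 ** lie b x') ** lie b y1).
  move=> Ix'; rewrite [w1 ** lie b x']lie_mulCr rng_mulBl.
  rewrite [lie (w1 ** b) _]lieC [lie w1 _]lieC !rng_mulNl.
  apply: (subgroupB sN); apply: (subgroupN sN).
    by apply: prodset_mul; [exact: IA|exact: Bb].
  rewrite -mulgA; apply: prodset_mul; first exact: IA.
  by have := Bb (b ** y1); rewrite lieMr liexx rng_mul0 add0r.
have E2 y1 x' z1 w1 : I x' -> prodset A B (w1 ** lie b x' ** z1 ** lie b y1).
  move=> Ix'.
  have -> : w1 ** lie b x' ** z1 ** lie b y1 =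
      lie (w1 ** lie b x') z1 ** lie b y1 + z1 ** w1 ** lie b x' ** lie b y1.
    by rewrite {2}/lie rng_mulBl !mulgA subrK.
  apply: (subgroupD sN); last exact: E1.
  apply: prodset_mul; last exact: Bb.
  apply: IA; have Ibx : I (lie b x').
    by apply: nI.1.1.2; case: (nI.1.2 x' b Ix').
  by case: (nI.1.2 _ w1 Ibx).
apply: (contains_ideal_lie_mul_lie nb nI sN) => x x' z y w Ix' _.
have -> : x ** lie b x' ** z ** lie b y ** w =
    x ** lie b x' ** z ** lie b (y ** w) - x ** lie b x' ** (z ** y) ** lie b w.
  by rewrite lieMr (rng_mulDr _ (lie b y ** w)) !mulgA addrK.
by apply: (subgroupB sN); apply: E2.
Qed.

(** Herstein's argument: RtR lies in N, the set of z with [z, R] inside L. The nonzero element tztwt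
    has t at both ends, so the ideal it generates stays inside N. *)
Lemma lie_ideal_contains L l l' : lie_ideal L -> L l -> L l' -> lie l l' <> 0 ->
  contains_lie_ideal L.
Proof.
move=> lL Ll Ll' ll'; set t := lie l l' in ll'.
pose N := [set z | forall r, L (lie z r)].
have sN : subgroup N.
  split=> [r|x y Nx Ny r];
    first by rewrite /lie rng_mul0 rng_mulr0 subrr; apply: lL.1.1.
  by rewrite lieBl; apply: lL.1.2.
have NP x y : N (x ** t ** y) by move=> r; apply: lie_ideal_lieMlieM.
have [z z0] := prime_neq0 ll' ll'; have [w w0] := prime_neq0 z0 ll'.
have [|r|s|s r|I nI IN] := contains_ideal_core sN w0;
  last by exists I => // x y /IN; apply.
- by have := NP (t ** z) (w ** t); rewrite !mulgA.
- by have := NP (t ** z) (w ** t ** r); rewrite !mulgA.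
- by have := NP (s ** t ** z) (w ** t); rewrite !mulgA.
- by have := NP (s ** t ** z) (w ** t ** r); rewrite !mulgA.
Qed.

Lemma lie_ideal_sum K L : lie_ideal K -> lie_ideal L ->
  lie_ideal [set z | exists k l, [/\ K k, L l & z = k + l]].
Proof.
move=> lK lL; apply: lie_idealI; first split.
- by exists 0, 0; rewrite addr0; split=> //; [apply: lK.1.1|apply: lL.1.1].
- move=> _ _ [k [l [Kk Ll ->]]] [k' [l' [Kk' Ll' ->]]].
  exists (k - k'), (l - l'); rewrite opprD addrACA.
  by split=> //; [apply: lK.1.2|apply: lL.1.2].
move=> _ r [k [l [Kk Ll ->]]]; exists (lie k r), (lie l r); rewrite lieDl.
by split=> //; apply: lie_ideal_lie.
Qed.

Definition commuting K L := forall x y, K x -> L y -> lie x y = 0.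

Lemma commuting_lieM L a b x y z : lie_ideal L -> commuting L L -> L a -> L b ->
  lie a x ** y ** lie b z = - (lie b x ** y ** lie a z).
Proof.
move=> lL cL La Lb; apply: lie_mul_lie => r.
by apply: cL => //; apply: lie_ideal_lie.
Qed.

(* t = [a, b] is central, because t y [t, z] = - [t, b] y [a, z] = 0. Then
   t[K, R]K and t[K, R]L lie in KL, and [a, R](K + L) contains an ideal. *)
Lemma contains_ideal_commuting K L a b : lie_ideal K -> lie_ideal L ->
  commuting K K -> commuting L L -> K a -> L b -> lie a b <> 0 ->
  contains_ideal (prodset K L).
Proof.
move=> lK lL cK cL Ka Lb t0; set t := lie a b in t0.
have Kt : K t by apply: lie_ideal_lie.
have Lt : L t by apply: lie_ideal_liel.
have ct z : lie t z = 0.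
  have [y||//] := @rng_primeP R t (lie t z); last by move/t0.
  by rewrite (commuting_lieM _ _ _ lK cK Ka Kt) (cL t b Lt Lb) !rng_mul0 oppr0.
have tC z : t ** z = z ** t by apply/eqP; rewrite -subr_eq0; apply/eqP/ct.
pose M := [set z | exists k l, [/\ K k, L l & z = k + l]].
(* K and L are each commutative, but K + L contains both a and b, so Herstein's argument applies to
   it. *)
have QM : contains_lie_ideal M.
  apply: (lie_ideal_contains (lie_ideal_sum lK lL) _ _ t0).
    by exists a, 0; rewrite addr0; split=> //; apply: lL.1.1.
  by exists 0, b; rewrite add0r; split=> //; apply: lK.1.1.
have na : ~ center R a by move=> /(_ b).
pose A := [set z | exists y, z = lie a y].
have [J nJ JN] : contains_ideal (prodset A M).
  by apply: (contains_ideal_prodsetl na) QM => y; exists y.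
have sN := subgroup_prodset K L.
have tJ z : J z -> prodset K L (t ** z).
  move/JN; move: z; apply: prodset_ind => [|_ _ [x ->] [k [l [Kk Ll ->]]]].
    exact: subgroup_mull.
  (* Since a commutes with K, [a, x]k = [a, xk] lies in K, and t, moved to the right, serves as the
     factor from L. For l, the factor t goes inside: t[a, x] = [a, tx] lies in K. *)
  rewrite /= rng_mulDr rng_mulDr; apply: (subgroupD sN).
    have -> : lie a x ** k = lie a (x ** k).
      by rewrite lieMr (cK a k) // rng_mulr0 addr0.
    by rewrite tC; apply: prodset_mul => //; apply: lie_ideal_lie.
  have -> : t ** (lie a x ** l) = lie a (t ** x) ** l.
    by rewrite lieMr (cK a t) // rng_mul0 add0r mulgA.
  by apply: prodset_mul => //; apply: lie_ideal_lie.
have [Ji [w Jw w0]] := nJ.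
have tw0 : t ** w <> 0.
  have [r trw] := prime_neq0 t0 w0; move=> tw; apply: trw.
  by rewrite tC -mulgA tw rng_mulr0.
have JM s r : J (s ** w ** r) by case: (Ji.2 w s Jw) => _ Jsw; case: (Ji.2 _ r Jsw).
apply: (contains_ideal_core sN tw0) => [|r|s|s r].
- exact: tJ.
- by rewrite -mulgA; apply: tJ; case: (Ji.2 w r Jw).
- by rewrite mulgA -(tC s) -mulgA; apply: tJ; case: (Ji.2 w s Jw).
- by have := tJ _ (JM s r); rewrite !mulgA (tC s).
Qed.

(** If NL contains a nonzero ideal, it contains some [I, R], so (NL)L contains a nonzero ideal
    again. As [powset] nests to the right, the induction shifts one factor L into N. *)
Lemma contains_ideal_powsetr L N n : lie_ideal L -> noncentral L -> (0 < n)%N ->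
  contains_ideal (prodset N L) -> contains_ideal (prodset N (powset L n)).
Proof.
move=> lL /noncentralP[b Lb nb]; case: n => // n _.
elim: n N => //= n IHn N PNL.
apply: contains_idealW (IHn (prodset N L) _); first exact: prodset_sub_assocr.
apply: (contains_ideal_prodsetr nb) => [y|]; first exact: lie_ideal_lie.
exact: contains_ideal_lie.
Qed.

Lemma contains_ideal_powsetl K N m : lie_ideal K -> noncentral K -> (0 < m)%N ->
  contains_ideal (prodset K N) -> contains_ideal (prodset (powset K m) N).
Proof.
move=> lK /noncentralP[a Ka na]; case: m => // m _ PKN.
elim: m => //= m IHm.
apply: contains_idealW (@prodset_sub_assocl _ _ _ _) _.
apply: (contains_ideal_prodsetl na) => [y|]; first exact: lie_ideal_lie.
exact: contains_ideal_lie.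
Qed.

End PrimeLemmas.

(** * The extended centroid, Martindale's lemma and commutative Lie ideals *)

Section Centroid.
Set Implicit Arguments.
Unset Strict Implicit.
Import GRing.Theory.
Local Open Scope ring_scope.
Local Open Scope quotient_scope.
Variable R : primeRngType.
Implicit Types (I K L : set R) (a b p q r s t x y z : R) (u v : Qs R).
Implicit Types alpha beta gamma : Qs R.

Local Notation C := (@extended_centroid R).
Local Notation "x %:Qs" := (Qs_inj x)
  (at level 1, left associativity, format "x %:Qs").

Lemma Qs_inj0 : 0%:Qs = 0 :> Qs R.
Proof. by apply: (@addrI _ (0%:Qs)); rewrite -Qs_injD !addr0. Qed.

Lemma Qs_injN x : (- x)%:Qs = - x%:Qs.
Proof. by apply: (@addrI _ (x%:Qs)); rewrite -Qs_injD !subrr Qs_inj0. Qed.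

Lemma Qs_injB x y : (x - y)%:Qs = x%:Qs - y%:Qs.
Proof. by rewrite Qs_injD Qs_injN. Qed.

Lemma centroidC beta u : C beta -> beta ** u = u ** beta.
Proof. by move=> /(_ u) /eqP; rewrite subr_eq0 => /eqP. Qed.

Lemma Qs_inj_lie x y : (lie x y)%:Qs = lie x%:Qs y%:Qs.
Proof. by rewrite Qs_injB !Qs_injM. Qed.

Lemma centroidCA beta u v : C beta -> u ** (beta ** v) = beta ** (u ** v).
Proof. by move=> Cb; rewrite !mulgA (centroidC u Cb). Qed.

(** The z with uz = 0 and uRz = 0 form an ideal of R. It contains some rxr <> 0, so u = 0 by
    faithfulness. *)
Lemma Qs_mul_inj_eq0 r u : r <> 0 -> (forall y, u ** y%:Qs ** r%:Qs = 0) -> u = 0.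
Proof.
move=> r0 ur; have [x rxr] := prime_neq0 r0 r0.
pose I := [set z | u ** z%:Qs = 0 /\ forall y, u ** (y ** z)%:Qs = 0].
apply: (@Qs_faithful _ I); last by left=> z [].
split; last first.
  by exists (r ** x ** r) => //; split=> [|y]; rewrite ?(mulgA y) Qs_injM mulgA.
split; first split.
- by split=> [|y]; rewrite ?rng_mulr0 Qs_inj0 rng_mulr0.
- move=> y z [uy uy'] [uz uz'].
  by split=> [|t]; rewrite ?rng_mulBr Qs_injB rng_mulBr ?uy ?uz ?uy' ?uz' subrr.
move=> z t [uz uz']; split; split=> [|y]; rewrite ?(mulgA y) //.
  by rewrite Qs_injM mulgA uz rng_mul0.
by rewrite Qs_injM mulgA uz' rng_mul0.
Qed.

Lemma centroid_subgroup : subgroup C.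
Proof.
split=> [y|x y Cx Cy z]; first by rewrite /lie rng_mul0 rng_mulr0 subrr.
by rewrite lieBl Cx Cy subrr.
Qed.

Lemma centroidM beta gamma : C beta -> C gamma -> C (beta ** gamma).
Proof. by move=> Cb Cc z; rewrite lieMl Cb Cc rng_mul0 rng_mulr0 addr0. Qed.

(** For x in the domain of q, both x and qx lie in R, whence uqx = (qx)u = q(xu) = qux. *)
Lemma centroidP u : (forall x, lie u x%:Qs = 0) -> C u.
Proof.
move=> u0; have uC x : u ** x%:Qs = x%:Qs ** u.
  by apply/eqP; rewrite -subr_eq0; apply/eqP/u0.
 elim/Qs_ind=> q; apply: (Qs_faithful (bdom_ideal q)); left=> x qx.
rewrite /lie rng_mulBl -!mulgA Qs_lact // !uC mulgA Qs_lact //.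
exact: subrr.
Qed.

(** The relation [G] is single-valued by primeness and respects multiplication on both sides. Its
    domain is thus an ideal, and the resulting bimodule map serves as both left and right action of
    a central element. *)
Lemma martindale p r s : r <> 0 -> (forall y, p ** y ** r = r ** y ** s) ->
  exists2 gamma, C gamma & gamma ** r%:Qs = p%:Qs.
Proof.
move=> r0 prs.
(* If p = gamma r, the hypothesis forces s = gamma r as well, and then [G z w] says w = gamma z. *)
pose G z w := forall y, w ** y ** r = z ** y ** s.
pose D := [set z | exists w, G z w].
have G_inj z w w' : G z w -> G z w' -> w = w'.
  move=> Gw Gw'; apply: contrapT => ww'.
  have [//|y] := @prime_neq0 R (w - w') r _ r0.
    by move=> /eqP; rewrite subr_eq0 => /eqP.
  by rewrite !rng_mulBl Gw Gw' subrr.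
have GB z z' w w' : G z w -> G z' w' -> G (z - z') (w - w').
  by move=> Gw Gw' y; rewrite !rng_mulBl Gw Gw'.
have GD z z' w w' : G z w -> G z' w' -> G (z + z') (w + w').
  by move=> Gw Gw' y; rewrite !rng_mulDl Gw Gw'.
have GMr z w x : G z w -> G (z ** x) (w ** x).
  by move=> Gw y; rewrite -!(mulgA _ x y) Gw.
have GMl z w x : G z w -> G (x ** z) (x ** w).
  by move=> Gw y; rewrite -!mulgA (mulgA w) Gw !mulgA.
have Dr : D r by exists p.
have nD : nonzero_ideal D.
  split; last by exists r.
  split; first split.
  - by exists 0 => y; rewrite !rng_mul0.
  - by move=> x y [w Gw] [w' Gw']; exists (w - w'); apply: GB.
  move=> x y [w Gw]; split.
    by exists (w ** y); apply: GMr.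
  by exists (y ** w); apply: GMl.
have /boolp.choice[f fG] z : exists w, D z -> G z w.
  by have [[w Gw]|nDz] := pselect (D z); [exists w|exists 0].
have fE z w : G z w -> f z = w.
  by move=> Gw; apply: (@G_inj z) => //; apply: fG; exists w.
have fD x y : D x -> D y -> f (x + y) = f x + f y.
  by move=> /fG Gx /fG Gy; apply: fE; apply: GD.
have fMr x y : D x -> f (x ** y) = f x ** y by move=> /fG Gx; apply/fE/GMr.
have fMl x y : D x -> f (y ** x) = y ** f x by move=> /fG Gx; apply/fE/GMl.
have fb x y : D x -> D y -> x ** f y = f x ** y.
  by move=> Dx Dy; rewrite -fMl // fMr.
pose g := Bimult nD fD fD fMr fMl fb.
exists (\pi_(Qs R) g); last by rewrite (@Qs_lact R g) //= (fE r p).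
apply: centroidP => x; apply: (Qs_faithful nD); left=> z Dz.
rewrite /lie rng_mulBl -!mulgA -Qs_injM !(@Qs_lact R g) //=;
  last by case: (nD.1.2 z x Dz).
by rewrite -Qs_injM fMl // subrr.
Qed.

(** Since gamma is central, its annihilator in R is a two-sided ideal. *)
Lemma centroid_eq0 gamma x : C gamma -> x <> 0 -> gamma ** x%:Qs = 0 -> gamma = 0.
Proof.
move=> Cg x0 gx.
have nI : nonzero_ideal [set z | gamma ** z%:Qs = 0].
  split; last by exists x.
  split; first split=> [|y z gy gz] /=; first by rewrite Qs_inj0 rng_mulr0.
    by rewrite Qs_injB rng_mulBr gy gz subrr.
  move=> y z gy; split; rewrite /= Qs_injM mulgA; first by rewrite gy rng_mul0.
  by rewrite (centroidC _ Cg) -mulgA gy rng_mulr0.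
by apply: (Qs_faithful nI); left.
Qed.

(* The quotient is Martindale's element taking beta x to gamma x, where x is
   taken in the domains of both. *)
Lemma centroid_div beta gamma : C beta -> C gamma -> beta <> 0 ->
  exists2 delta, C delta & delta ** beta = gamma.
Proof.
elim/Qs_ind: beta => p; elim/Qs_ind: gamma => q Cp Cq p0.
have [_ [x [px qx] x0]] := nonzero_idealI (bdom_ideal p) (bdom_ideal q).
have lp := Qs_lact px; have lq := Qs_lact qx.
have r0 : lact p x <> 0.
  by move=> r0; apply: p0; apply: (centroid_eq0 Cp x0); rewrite lp r0 Qs_inj0.
have [y|delta Cd dE] := @martindale (lact q x) (lact p x) (lact q x) r0.
  apply: Qs_inj_injective; rewrite !Qs_injM -lp -lq.
  by rewrite -!mulgA !(centroidCA _ _ Cp) !(centroidCA _ _ Cq).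
exists delta => //; apply/eqP; rewrite -subr_eq0; apply/eqP.
apply: (@centroid_eq0 _ x) => //.
  by apply: (subgroupB centroid_subgroup) => //; apply: centroidM.
by rewrite rng_mulBl -mulgA lp dE lq subrr.
Qed.

(** This provides a commutator [a, x] that is no C-multiple of a. Otherwise, comparing x with ax
    gives a[a, y][a, x] = 0, and primeness successively gives a[a, y] = 0 and a = 0. *)
Lemma lie_mul_noncomm a : ~ center R a ->
  exists x y, lie a x ** y ** a <> a ** y ** lie a x.
Proof.
move=> na; apply: contrapT => H.
have E x y : lie a x ** y ** a = a ** y ** lie a x.
  by apply: contrapT => H'; apply: H; exists x, y.
have alala y x : a ** lie a y ** lie a x = 0.
  have e : a ** (a ** y ** lie a x) = a ** y ** (a ** lie a x).
    by rewrite -E; have := E (a ** x) y; rewrite lieMr liexx rng_mul0 add0r -!mulgA.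
  rewrite [lie a y]/lie (rng_mulBr a (a ** y)) (rng_mulBl _ _ (lie a x)).
  by move: e; rewrite !mulgA => ->; rewrite subrr.
have [z az] := noncentral_lie na.
have ala y : a ** lie a y = 0.
  have [x|//|//] := @rng_primeP R (a ** lie a y) (lie a z).
  by have := alala y (x ** z); rewrite lieMr rng_mulDr !mulgA alala rng_mul0 add0r.
have [x|a0|//] := @rng_primeP R a (lie a z).
  by have := ala (x ** z); rewrite lieMr rng_mulDr !mulgA ala rng_mul0 add0r.
by apply: na => y; rewrite a0 /lie rng_mul0 rng_mulr0 subrr.
Qed.

Lemma CaC_subgroup a : subgroup (CaC a).
Proof.
have [C0 CB] := centroid_subgroup; split.
  by exists 0 => //; exists 0; rewrite // rng_mul0 addr0.
move=> _ _ [b Cb [c Cc <-]] [b' Cb' [c' Cc' <-]].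
exists (b - b'); first exact: CB.
by exists (c - c'); [exact: CB|rewrite rng_mulBl opprD addrACA].
Qed.

Lemma CaC_scale a u gamma : CaC a u -> C gamma -> CaC a (gamma ** u).
Proof.
move=> [b Cb [c Cc <-]] Cg; exists (gamma ** b); first exact: centroidM.
by exists (gamma ** c); [exact: centroidM|rewrite rng_mulDr mulgA].
Qed.

(** Martindale's lemma gives [b, z] = gamma [a, z]. Then ([b, x] + gamma [a, x])y[a, z] = 0 for all
    x and y, so b + gamma a commutes with R and is the constant term of b. *)
Lemma commuting_CaC L a b : lie_ideal L -> commuting L L -> L a -> ~ center R a ->
  L b -> CaC a (b%:Qs).
Proof.
move=> lL cL La na Lb; have [z az] := noncentral_lie na.
have E x y : lie b x ** y ** lie a z = - (lie a x ** y ** lie b z).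
  exact: (commuting_lieM x y z lL cL Lb La).
have [y|gamma Cg gE] := @martindale (lie b z) (lie a z) (- lie b z) az.
  by rewrite rng_mulNr; apply: E.
exists (- gamma); first exact: (subgroupN centroid_subgroup).
exists (b%:Qs + gamma ** a%:Qs); last by rewrite rng_mulNl addrCA addNr addr0.
apply: centroidP => x; rewrite lieDl lieMl (Cg _) rng_mul0 addr0 -!Qs_inj_lie.
apply: (Qs_mul_inj_eq0 az) => y.
rewrite !rng_mulDl -!Qs_injM E Qs_injN -!mulgA Qs_injM Qs_injM -gE.
by rewrite !(centroidCA _ _ Cg) -!Qs_injM addNr.
Qed.

Lemma Cspan_commuting L a : lie_ideal L -> commuting L L -> L a -> ~ center R a ->
  Cspan L = CaC a.
Proof.
move=> lL cL La na; apply/seteqP; split.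
  apply: (prodset_ind (CaC_subgroup a)) => _ beta [b Lb <-] Cb.
  rewrite -centroidC //; apply: CaC_scale => //.
  exact: (commuting_CaC lL).
have sS : subgroup (Cspan L) by exact: subgroup_prodset.
have SZ beta b : C beta -> L b -> Cspan L (beta ** b%:Qs).
  by move=> Cb Lb; rewrite centroidC //; apply: prodset_mul => //; exists b.
move=> _ [alpha Ca [gamma Cg <-]]; apply: (subgroupD sS); first exact: SZ.
(* It remains to put C inside LC. Write [a, x] = alpha' a + beta; here beta <> 0, since alpha' a
   would satisfy the excluded identity. So beta lies in LC, and gamma is a C-multiple of beta. *)
have [x [y xy]] := lie_mul_noncomm na.
have Lax : L (lie a x) by exact: lie_ideal_lie.
have [alpha' Ca' [beta Cb axE]] := commuting_CaC lL cL La na Lax.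
have b0 : beta <> 0.
  move=> b0; apply: xy; apply: Qs_inj_injective; rewrite !Qs_injM -axE b0 addr0.
  by rewrite -!mulgA !(centroidCA _ _ Ca').
have [delta Cd <-] := centroid_div Cb Cg b0.
have -> : beta = (lie a x)%:Qs - alpha' ** a%:Qs by rewrite -axE addrC addKr.
rewrite rng_mulBr mulgA; apply: (subgroupB sS); apply: SZ => //.
exact: centroidM.
Qed.

End Centroid.

Theorem theorem1p7 (R : primeRngType) (K L : set R) (m n : nat)
    (lieK : lie_ideal K) (lieL : lie_ideal L)
    (ncK : noncentral K) (ncL : noncentral L)
    (m_gt0 : (0 < m)%N) (n_gt0 : (0 < n)%N)
    (not_exc : ~ (forall a : R, K a -> ~ center R a ->
                    Cspan K = CaC a /\ Cspan L = CaC a)) :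
  exists2 I : set R, nonzero_ideal I & I `<=` prodset (powset K m) (powset L n).
Proof.
suff KL : contains_ideal (prodset K L).
  by apply: contains_ideal_powsetl => //; apply: contains_ideal_powsetr.
have [a Ka na] := noncentralP ncK; have [b Lb nb] := noncentralP ncL.
have split_commuting (A B : set R) : commuting A B \/
    exists x y, [/\ A x, B y & lie x y <> GRing.zero].
  have [|nAB] := pselect (commuting A B); [by left|right].
  apply: contrapT => H; apply: nAB => x y Ax By; apply: contrapT => xy.
  by apply: H; exists x, y.
have [cL|[l [l' [Ll Ll' ll']]]] := split_commuting L L; last first.
  apply: (contains_ideal_prodsetl na) => [y|]; first exact: lie_ideal_lie.
  exact: (lie_ideal_contains lieL Ll Ll').
have [cK|[k [k' [Kk Kk' kk']]]] := split_commuting K K; last first.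
  apply: (contains_ideal_prodsetr nb) => [y|]; first exact: lie_ideal_lie.
  exact: (lie_ideal_contains lieK Kk Kk').
have [cKL|[k [l [Kk Ll kl]]]] := split_commuting K L; last first.
  exact: (contains_ideal_commuting lieK lieL cK cL Kk Ll).
case: not_exc => {}a {}Ka {}na; split; first exact: Cspan_commuting.
rewrite (Cspan_commuting lieL cL Lb nb).
(* Now LC = Cb + C. As K + L is commutative and contains both a and b, Ca + C and Cb + C are both
   its C-span. *)
pose M := [set z | exists k l, [/\ K k, L l & z = GRing.add k l]].
have lM : lie_ideal M by exact: lie_ideal_sum.
have cM : commuting M M.
  move=> _ _ [k [l [Kk Ll ->]]] [k' [l' [Kk' Ll' ->]]].
  rewrite lieDl !lieDr (cK k k') // (cKL k l') // (cL l l') // lieC (cKL k' l) //.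
  by rewrite GRing.oppr0 !GRing.addr0.
have Ma : M a by exists a, GRing.zero; rewrite GRing.addr0; split=> //; exact: lieL.1.1.
have Mb : M b by exists GRing.zero, b; rewrite GRing.add0r; split=> //; exact: lieK.1.1.
by rewrite -(Cspan_commuting lM cM Ma na) -(Cspan_commuting lM cM Mb nb).
Qed.
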